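(* Let $A$ be a bounded linear operator on a complex Hilbert space $\mathcal{H}$, and let $W(A)$ be its numerical range. Let $\lambda \in \partial W(A)$ be a point of infinite upper curvature of $\partial W(A)$. Then $\lambda \in \sigma_{ap}(A)$, the approximate point spectrum of $A$.
   Context: The numerical range of a bounded linear operator $A$ on a complex Hilbert space $(\mathcal{H}, \langle \cdot,\cdot\rangle)$ is $W(A) = \{\langle Af, f\rangle : f \in \mathcal{H}, \|f\| = 1\}$. It is a bounded convex subset of $\mathbb{C}$ (not necessarily open or closed), and $\partial W(A)$ denotes its topological boundary in $\mathbb{C}$; a boundary point need not belong to $W(A)$. The approximate point spectrum $\sigma_{ap}(A)$ is the set of all $\lambda$ in the spectrum $\sigma(A)$ for which there is a sequence of unit vectors $(u_n) \subset \mathcal{H}$ with $(A-\lambda)u_n \to 0$ as $n \to \infty$. Points of infinite upper curvature: identify $\mathbb{C}$ with $\mathbb{R}^2$, let $\Omega \subset \mathbb{R}^2$ be a convex set and let $\lambda \in \partial\Omega$. The point $\lambda$ is a corner point of $\Omega$ if $\Omega$ is contained in a sector with vertex $\lambda$ and angle less than $\pi$. Every corner point is, by definition, a point of infinite upper curvature. If $\lambda$ is not a corner point, apply a translation and a rotation of the plane taking $\lambda$ to $0$ and $\Omega$ to a convex set $\Omega'$ that is contained in the closed upper half-plane and has the real line as its unique supporting line through $0$. The upper curvature of $\partial\Omega$ at $\lambda$ is $$\gamma_u(\lambda) := \limsup_{\substack{(x,y)\to 0\\ x\neq 0,\ (x,y)\in\partial\Omega'}} \frac{y}{x^2} \in [0,\infty],$$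 and $\lambda$ is called a point of infinite upper curvature if $\gamma_u(\lambda) = \infty$. *)

(* Defs.v *)
From HB Require Import structures.
From mathcomp Require Import all_boot all_order all_algebra complex.
From mathcomp Require Import all_classical all_reals all_analysis.

Set Implicit Arguments.
Unset Strict Implicit.
Unset Printing Implicit Defensive.

Import Order.TTheory GRing.Theory Num.Theory Num.Def.
Import numFieldNormedType.Exports.

Local Open Scope classical_set_scope.
Local Open Scope complex_scope.
Local Open Scope ring_scope.

(* The usual topology of the plane: that of the modulus on [R[i]]. *)
HB.instance Definition _ (R : realType) := NormedModule.copy R[i] R[i]^o.

Section Operators.
Context {R : realType} {H : completeNormedModType R[i]}.

(* A [conjC]-dot product is linear on the left and antilinear on the right.
   [H] is a Hilbert space when its complete norm is the one induced by [dot]. *)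
Definition induces_norm (dot : {dot H for conjC}) : Prop :=
  forall x : H, `|x| ^+ 2 = dot x x.

Definition bounded_operator (A : {linear H -> H}) : Prop :=
  exists M : R, forall x : H, `|A x| <= M%:C * `|x|.

Definition numerical_range (dot : {dot H for conjC}) (A : {linear H -> H}) :
    set R[i] :=
  [set dot (A f) f | f in [set f : H | `|f| = 1]].

Definition spectrum (A : {linear H -> H}) : set R[i] :=
  [set l | ~ exists B : {linear H -> H}, [/\ bounded_operator B,
      forall x, B (A x - l *: x) = x & forall x, A (B x) - l *: B x = x]].

Definition approximate_point_spectrum (A : {linear H -> H}) : set R[i] :=
  [set l | spectrum A l /\
    exists u : nat -> H, (forall n, `|u n| = 1) /\
      (fun n => A (u n) - l *: u n) @ \oo --> (0 : H)].

End Operators.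

Section PlaneGeometry.
Context {R : realType}.
Implicit Types (O L : set R[i]) (p u : R[i]).

Definition boundary O : set R[i] := closure O `\` interior O.

(* The closed sector with vertex [p] and angle [b], its sides pointing in the
   directions [a] and [a + b]. *)
Definition sector p (a b : R) : set R[i] :=
  [set z | exists r t : R, [/\ 0 <= r, a <= t <= a + b &
             z = p + r%:C * (cos t +i* sin t)]].

Definition corner_point O p : Prop :=
  boundary O p /\ exists a b : R, 0 < b < pi /\ O `<=` sector p a b.

Definition supporting_line O p L : Prop :=
  exists a b : R,
    let l z := a * complex.Re (z - p) + b * complex.Im (z - p) in
    [/\ (a != 0) || (b != 0), L = [set z | l z = 0]
      & O `<=` [set z | 0 <= l z]].

(* The image of [O] under the translation taking [p] to 0 followed by the
   rotation [u], for [`|u| = 1]. *)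
Definition rigid_image p u O : set R[i] := [set u * (z - p) | z in O].

Definition normal_position O : Prop :=
  O `<=` [set z | 0 <= complex.Im z] /\
  forall L, supporting_line O 0 L <-> L = [set z | complex.Im z = 0].

(* For [O] in normal position, with 0 on its boundary. *)
Definition upper_curvature O : \bar R :=
  limf_esup (fun z : R[i] => (complex.Im z / complex.Re z ^+ 2)%:E)
    (within [set z | complex.Re z != 0 /\ boundary O z] (nbhs (0 : R[i]))).

(* Meant for convex [O].  At a boundary point that is not a corner the rotation
   [u] is unique, except when [O] lies on a line: then [u] and [- u] both occur,
   and give the same curvature. *)
Definition infinite_upper_curvature O p : Prop :=
  corner_point O p \/
  [/\ boundary O p, ~ corner_point O p &
    exists u, [/\ `|u| = 1, normal_position (rigid_image p u O) &
                  upper_curvature (rigid_image p u O) = +oo%E]].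

End PlaneGeometry.

(* Main.v *)
Require Import Defs.
From mathcomp Require Import all_boot all_order all_algebra complex.
From mathcomp Require Import all_classical all_reals all_analysis.
From mathcomp Require Import ring lra.
Import Order.TTheory GRing.Theory Num.Theory.
Import Num.Def.
Import numFieldNormedType.Exports.
Local Open Scope classical_set_scope.
Local Open Scope complex_scope.
Local Open Scope ring_scope.

(** Why the theorem is true.  Suppose that [lambda] is a boundary point of the
    numerical range which is not an approximate eigenvalue, and put
    [T = u (A - lambda)], the rotation [u] being chosen so that [W(T)] lies in
    the closed upper half-plane; 0 is then in the closure of [W(T)] and
    [k |f|^2 <= |T f|^2] for some [k > 0] ([bounded_below]).

    The heart of the matter is [tangent_points]: [W(T)] then contains, at every
    small scale [s], a point on each side of the imaginary axis at distance at
    least [c s] from it and at height at most [C s^2].  Take a unit vector [f]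
    with [<T f, f>] of size [s^2], and perturb it in the direction [g = T f].
    For complex [b] with [|b| = s],
      [<T (f + b g), f + b g> = <T f, f> + b^* |g|^2 + b <T g, f> + |b|^2 <T g, g>],
    whose first and last terms are of size [s^2].  Its imaginary part is
    nonnegative for every [b].  Comparing [b = s] with [b = - s] shows that the
    imaginary part is O(s^2) for both; and [b = i s] gives
    [Re <T g, f> >= |g|^2 - O(s)], so that the real parts at [b = s] and
    [b = - s] are at least [2 s |g|^2 - O(s^2)] and at most
    [- 2 s |g|^2 + O(s^2)].  Since [|g|^2 >= k], this is what is wanted.

    Near 0 the set [W(T)] therefore rises at most quadratically on both sides.
    At a corner it would rise at least linearly ([sector_rotation]), which is
    impossible.  Otherwise, infinite upper curvature provides boundary points
    [x + i y] arbitrarily close to 0 with [y / x^2] arbitrarily large.  With the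
    scale [s] given by [y = 2 C s^2], such a point lies well inside the triangle
    spanned by the two points at scale [s] and a fixed point of [W(T)] of
    positive height ([interior_above_parabola]).  As the numerical range is
    convex ([numerical_range_convex], the Toeplitz-Hausdorff theorem), the point
    is interior, a contradiction ([upper_curvature_finite]). *)

Set Implicit Arguments.
Unset Strict Implicit.
Unset Printing Implicit Defensive.

(** * Convex plane sets along a supporting line *)

Section PlaneConvexity.
Variable R : realType.
Local Notation Re := (@complex.Re R).
Local Notation Im := (@complex.Im R).

Definition convex_set (W : set R[i]) : Prop :=
  forall z w (t : R), W z -> W w -> 0 <= t <= 1 ->
    W ((1 - t)%:C * z + t%:C * w).

(** A quadratic bound, on both sides of 0, for the height of a convex set above
    the real line.  It is expressed by points of the set itself, at all small
    scales, so that a scale can be matched with any given boundary point. *)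
Definition hugs_real_axis (W : set R[i]) : Prop :=
  exists C c s0 : R, [/\ 0 < C, 0 < c, 0 < s0 &
    forall s : R, 0 < s <= s0 -> exists z w,
      [/\ W z, W w &
      [/\ c * s <= Re z, Re w <= - (c * s),
          Im z <= C * s ^+ 2 & Im w <= C * s ^+ 2]]].

Lemma Re_Im_lt_norm (z : R[i]) (e : R) : `|z| < e%:C ->
  `|Re z| < e /\ `|Im z| < e.
Proof.
rewrite normc_def ltcR => h; split; apply: le_lt_trans h.
  by rewrite -sqrtr_sqr ler_wsqrtr// lerDl sqr_ge0.
by rewrite -sqrtr_sqr ler_wsqrtr// lerDr sqr_ge0.
Qed.

Lemma nbhs_square (z : R[i]) (e : R) : 0 < e ->
  nbhs z [set w | `|Re (w - z)| < e /\ `|Im (w - z)| < e].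
Proof.
move=> e0; apply/nbhs_ballP; exists e%:C => /=; first by rewrite ltcR.
by move=> w; rewrite /ball /= distrC => /Re_Im_lt_norm.
Qed.

Lemma convex_level W z w y : convex_set W -> W z -> W w ->
  Im z <= y <= Im w -> Im z < Im w ->
  exists t : R, [/\ 0 <= t <= 1, t * (Im w - Im z) = y - Im z &
    W (((1 - t) * Re z + t * Re w) +i* y)].
Proof.
move=> cW Wz Ww /andP[zy yw] zw.
have [t t01 tE] : exists2 t : R, 0 <= t <= 1 & t * (Im w - Im z) = y - Im z.
  have d0 : 0 < Im w - Im z by rewrite subr_gt0.
  exists ((y - Im z) / (Im w - Im z)); last by rewrite divfK ?gt_eqF.
  by apply/andP; split; [apply: divr_ge0|rewrite ler_pdivrMr//]; lra.
exists t; split => //; move: (cW z w t Wz Ww t01).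
have -> : y = (1 - t) * Im z + t * Im w by move: tE; lra.
by case: z w {Wz Ww t01 zy yw zw tE} => [z1 z2] [w1 w2]; simpc.
Qed.

(** The segment from the low point [z] to the high point [q] is followed up to
    height [y], of order [s^2].  This consumes a fraction [t] of order [s^2] of
    the segment, so the abscissa has changed by O(s^2) only and keeps its size
    [c s].  The sign [sg] serves both sides of the imaginary axis. *)
Lemma convex_reach W (C c s sg y : R) z q : convex_set W -> W z -> W q ->
  0 < C -> 0 < c -> 0 < s -> `|sg| = 1 ->
  c * s <= sg * Re z -> 0 <= Im z <= C * s ^+ 2 ->
  C * s ^+ 2 <= y <= 3 * C * s ^+ 2 ->
  0 < Im q -> 12 * C * s ^+ 2 <= Im q -> 24 * C * s * `|Re q| <= c * Im q ->
  exists2 x : R, c * s / 4 <= sg * x & W (x +i* y).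
Proof.
move=> cW Wz Wq C0 c0 s0 sg1 cz /andP[z0 zC] /andP[Cy yC] q0 q1 q2.
have Cs : 0 < C * s ^+ 2 by rewrite mulr_gt0// exprn_gt0.
have [||t [/andP[t0 t1] tE Wt]] := convex_level (y := y) cW Wz Wq; [|lra|].
  by apply/andP; split; lra.
exists ((1 - t) * Re z + t * Re q) => //.
have th : t * Im q <= 6 * C * s ^+ 2.
  (* the segment rises by at least half the height of its upper end *)
  have : t * (Im q / 2) <= t * (Im q - Im z) by rewrite ler_wpM2l//; lra.
  by lra.
have t2 : t <= 1 / 2 by rewrite -(ler_pM2r q0); lra.
have tq : t * `|Re q| <= c * s / 4.
  rewrite -(ler_pM2r q0).
  have := ler_wpM2r (normr_ge0 (Re q)) th.
  have := ler_wpM2l (ltW s0) q2.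
  lra.
have : (1 / 2) * (c * s) <= (1 - t) * (sg * Re z).
  by apply: ler_pM; try lra; rewrite mulr_ge0// ltW.
have : - (t * `|Re q|) <= t * (sg * Re q).
  rewrite -mulrN ler_wpM2l// lerNl (le_trans (ler_norm _))//.
  by rewrite normrN normrM sg1 mul1r.
lra.
Qed.

Lemma convex_box W (C c s x y : R) z w q : convex_set W ->
  W z -> W w -> W q -> W `<=` [set z | 0 <= Im z] ->
  0 < C -> 0 < c -> 0 < s ->
  c * s <= Re z -> Re w <= - (c * s) ->
  Im z <= C * s ^+ 2 -> Im w <= C * s ^+ 2 ->
  0 < Im q -> 12 * C * s ^+ 2 <= Im q -> 24 * C * s * `|Re q| <= c * Im q ->
  `|x| <= c * s / 4 -> C * s ^+ 2 <= y <= 3 * C * s ^+ 2 ->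
  W (x +i* y).
Proof.
move=> cW Wz Ww Wq Wpos C0 c0 s0 zR wR zI wI q0 q1 q2 xs ys.
have [||x1 x1c W1] :=
  @convex_reach W C c s 1 y z q cW Wz Wq C0 c0 s0 (normr1 _) _ _ ys q0 q1 q2.
- by rewrite mul1r.
- by rewrite zI andbT; exact: Wpos.
have [|||x2 x2c W2] :=
  @convex_reach W C c s (-1) y w q cW Ww Wq C0 c0 s0 _ _ _ ys q0 q1 q2.
- by rewrite normrN1.
- by rewrite mulN1r lerNr.
- by rewrite wI andbT; exact: Wpos.
have cs : 0 < c * s by rewrite mulr_gt0.
move: xs; rewrite ler_norml => /andP[xl xu].
have d0 : 0 < x1 - x2 by lra.
have [t t01 tE] : exists2 t : R, 0 <= t <= 1 & t * (x1 - x2) = x - x2.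
  exists ((x - x2) / (x1 - x2)); last by rewrite divfK ?gt_eqF.
  by apply/andP; split; [apply: divr_ge0|rewrite ler_pdivrMr//]; lra.
have := cW _ _ t W2 W1 t01; simpc => /=.
have -> : (1 - t) * x2 + t * x1 = x by move: tE; lra.
by have -> : (1 - t) * y + t * y = y by ring.
Qed.

(** The rectangle of heights between [C s^2] and [3 C s^2] provided by
    [convex_box] is a neighbourhood of [p]. *)
Lemma interior_above_parabola W (C c s : R) z w q p : convex_set W ->
  W z -> W w -> W q -> W `<=` [set z | 0 <= Im z] ->
  0 < C -> 0 < c -> 0 < s ->
  c * s <= Re z -> Re w <= - (c * s) ->
  Im z <= C * s ^+ 2 -> Im w <= C * s ^+ 2 ->
  0 < Im q -> 12 * C * s ^+ 2 <= Im q -> 24 * C * s * `|Re q| <= c * Im q ->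
  `|Re p| < c * s / 4 -> Im p = 2 * C * s ^+ 2 ->
  interior W p.
Proof.
move=> cW Wz Ww Wq Wpos C0 c0 s0 zR wR zI wI q0 q1 q2 px py.
have Cs : 0 < C * s ^+ 2 by rewrite mulr_gt0// exprn_gt0.
have e0 : 0 < Num.min (c * s / 4 - `|Re p|) (C * s ^+ 2).
  by rewrite lt_min subr_gt0 px.
apply: filterS (nbhs_square p e0) => -[x y] [].
case: p px py {e0} => [px py] /= hx hy; rewrite !lt_min => /andP[xs _] /andP[_ ys].
apply: (convex_box cW Wz Ww Wq Wpos C0 c0 s0) => //.
- have := ler_normD (x - px) px; rewrite subrK; lra.
- by move: ys; rewrite hy ltr_norml => /andP[? ?]; apply/andP; split; lra.
Qed.

Lemma upper_curvature_pinfty W (N e : R) :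
  upper_curvature W = +oo%E -> 0 < e ->
  exists2 z, boundary W z & [/\ Re z != 0, `|Im z| < e & N * Re z ^+ 2 < Im z].
Proof.
move=> Woo e0.
pose V := [set z | Re z != 0 /\ boundary W z] `&`
  [set z | `|Re z| < e /\ `|Im z| < e].
have FV : within [set z | Re z != 0 /\ boundary W z] (nbhs (0 : R[i])) V.
  apply: filterS (nbhs_square 0 e0) => z /=; rewrite subr0 => ez Bz; split => //.
have : ereal_sup ((fun z : R[i] => (Im z / Re z ^+ 2)%:E) @` V) = +oo%E.
  apply/eqP; rewrite eq_le leey -Woo /=; apply: ereal_inf_lbound.
  by exists V.
move=> supV.
have : (N%:E < ereal_sup ((fun z : R[i] => (Im z / Re z ^+ 2)%:E) @` V))%E.
  by rewrite supV ltry.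
move/ereal_sup_gt => [_ [z [[z0 Bz] [_ ze]] <-]] /=.
rewrite lte_fin ltr_pdivlMr ?exprn_even_gt0// => h.
by exists z.
Qed.

(** The point [q] of positive height exists because a set inside the real line
    has zero curvature.  Then the scale [s] of a boundary point [p] is read off
    from [Im p = 2 C s^2], and large curvature forces [|Re p|] to be small
    compared with [s]. *)
Lemma upper_curvature_finite W :
  convex_set W -> W `<=` [set z | 0 <= Im z] -> hugs_real_axis W ->
  upper_curvature W <> +oo%E.
Proof.
move=> cW Wpos [C [c [s0 [C0 c0 s00 tg]]]] Woo.
have [q Wq q0] : exists2 q, W q & 0 < Im q.
  have [p [clp _] [p0 _]] := upper_curvature_pinfty 0 Woo ltr01.
  rewrite mul0r => pI.
  have [q [Wq [_]]] := clp _ (nbhs_square p pI).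
  by rewrite raddfB /= ltr_norml => /andP[? ?]; exists q => //; lra.
(* the bounds after [s0] give what [convex_reach] asks of [s]; the [+ 1] keeps the
   denominator positive *)
pose s1 := Num.min s0 (Num.min 1 (Num.min (Im q / (12 * C))
  (c * Im q / (24 * C * (`|Re q| + 1))))).
have nq := normr_ge0 (Re q).
have s10 : 0 < s1.
  rewrite !lt_min s00 ltr01 /=; apply/andP; split; apply: divr_gt0 => //; [lra| |].
  - exact: mulr_gt0.
  - by apply: mulr_gt0; lra.
(* [32 C / c^2] makes [|Re p|] less than [c s / 4] *)
have [p [clp intp] [p0 pe pN]] :=
  upper_curvature_pinfty (32 * C / c ^+ 2) Woo
   (mulr_gt0 (mulr_gt0 (@ltr0n R 2) C0) (exprn_gt0 2 s10)).
apply: intp.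
have pI : 0 < Im p.
  apply: le_lt_trans pN; rewrite mulr_ge0 ?sqr_ge0// divr_ge0 ?sqr_ge0//.
  by rewrite mulr_ge0// ltW.
pose s := Num.sqrt (Im p / (2 * C)).
have s0' : 0 < s by rewrite sqrtr_gt0 divr_gt0// mulr_gt0.
have pE : Im p = 2 * C * s ^+ 2.
  rewrite sqr_sqrtr ?divr_ge0 ?mulr_ge0 ?ltW//.
  by field; rewrite gt_eqF.
have ss1 : s <= s1.
  move: pe; rewrite gtr0_norm// pE ltr_pM2l ?mulr_gt0// => h.
  by rewrite -(ler_pXn2r (ltn0Sn 1)) ?nnegrE ?ltW.
move: ss1; rewrite !le_min => /and4P[ss0 s_1 sq1 sq2].
have [z [w [Wz Ww [zR wR zI wI]]]] := tg s (introT andP (conj s0' ss0)).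
apply: (interior_above_parabola cW Wz Ww Wq Wpos C0 c0 s0' zR wR zI wI) => //.
- move: sq1; rewrite ler_pdivlMr ?mulr_gt0// => sq1.
  have s2 : s ^+ 2 <= s by rewrite expr2 ler_piMr// ltW.
  by have := ler_wpM2l (ltW C0) s2; lra.
- move: sq2; rewrite ler_pdivlMr; last by apply: mulr_gt0; lra.
  move=> sq2; apply: le_trans sq2.
  have := mulr_gt0 C0 s0'; lra.
- rewrite -(ltr_pXn2r (ltn0Sn 1)) ?nnegrE ?normr_ge0//; last first.
    by rewrite divr_ge0// mulr_ge0// ltW.
  move: pN; rewrite pE real_normK ?num_real// mulrAC ltr_pdivrMr ?exprn_gt0// => pN.
  rewrite -(ltr_pM2l C0).
  lra.
Qed.

(** The bisector of the sector is turned onto the imaginary axis, so that the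
    sector becomes [|arg z - pi/2| <= b/2], where [Im z >= cos (b/2) |z|]. *)
Lemma sector_rotation (p : R[i]) (a b : R) : 0 < b < pi ->
  exists2 u : R[i], `|u| = 1 & exists2 m : R, 0 < m &
  forall z, sector p a b z ->
    0 <= Im (u * (z - p)) /\ m * Re (u * (z - p)) <= Im (u * (z - p)).
Proof.
move=> /andP[b0 bpi].
pose h := pi / 2 - a - b / 2.
exists (cos h +i* sin h).
  by rewrite normc_def /= cos2Dsin2 sqrtr1.
have m0 : 0 < cos (b / 2) by rewrite cos_gt0_pihalf//; apply/andP; split; lra.
exists (cos (b / 2)) => // _ [r [t [r0 /andP[at1 at2] ->]]].
have -> : (cos h +i* sin h) * (p + r%:C * (cos t +i* sin t) - p) =
  (r * cos (t + h)) +i* (r * sin (t + h)).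
  rewrite cosD sinD; case: p => p1 p2; simpc; congr (_ +i* _); ring.
have sm : cos (b / 2) <= sin (t + h).
  have -> : sin (t + h) = cos (t + h - pi / 2).
    by rewrite cosB cos_pihalf sin_pihalf mulr0 add0r mulr1.
  have -> : cos (t + h - pi / 2) = cos `|t + h - pi / 2|.
    by case: ler0P; rewrite ?cosN.
  rewrite leNgt; apply/negP.
  rewrite ltr_cos ?in_itv /=.
  - by rewrite ltr_normr /h; lra.
  - by apply/andP; split; lra.
  - rewrite normr_ge0 /=; apply: (@le_trans _ _ (b/2)); last lra.
    by rewrite ler_norml /h; apply/andP; split; lra.
rewrite /=; split; first by rewrite mulr_ge0// (le_trans _ sm)// ltW.
rewrite mulrCA ler_wpM2l//; apply: le_trans sm.
by rewrite ler_piMr ?cos_le1// ltW.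
Qed.

(** A set rising linearly on one side of 0 leaves no room below a parabola. *)
Lemma hugs_real_axis_not_steep W (m : R) : 0 < m ->
  (forall z, W z -> m * Re z <= Im z) -> ~ hugs_real_axis W.
Proof.
move=> m0 steep [C [c [s0 [C0 c0 s00 tg]]]].
have mc : 0 < m * c by rewrite mulr_gt0.
pose s := Num.min s0 (m * c / (2 * C)).
have s_gt0 : 0 < s by rewrite lt_min s00; apply: divr_gt0; lra.
have /andP[ss0 sC] : (s <= s0) && (s <= m * c / (2 * C)) by rewrite -le_min.
have [z [w [/steep Wz _ [zR _ zI _]]]] := tg s (introT andP (conj s_gt0 ss0)).
move: sC; rewrite ler_pdivlMr; last lra.
move=> sC; have := ler_wpM2l (ltW s_gt0) sC.
have : m * (c * s) <= C * s ^+ 2.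
  by apply: le_trans zI; apply: le_trans Wz; rewrite ler_wpM2l// ltW.
have := mulr_gt0 mc s_gt0.
by lra.
Qed.

End PlaneConvexity.

(** * Numerical ranges *)

Section NumericalRange.
Variables (R : realType) (H : completeNormedModType R[i]).
Variable dot : {dot H for conjC}.
Implicit Types x y f g h : H.
Local Notation Re := (@complex.Re R).
Local Notation Im := (@complex.Im R).

Lemma dot_conj x y : dot y x = (dot x y)^*.
Proof. by rewrite hermC /= expr0 mul1r. Qed.

Lemma dotDl x y h : dot (x + y) h = dot x h + dot y h.
Proof. exact: linearDl. Qed.

Lemma dotDr x y h : dot x (y + h) = dot x y + dot x h.
Proof. exact: linearDr. Qed.

Lemma dotZl a x y : dot (a *: x) y = a * dot x y.
Proof. exact: linearZl_LR. Qed.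

Lemma dotZr a x y : dot x (a *: y) = a^* * dot x y.
Proof. exact: linearZr_LR. Qed.

Lemma dot_pencil (T : {linear H -> H}) f g (b : R[i]) :
  dot (T (f + b *: g)) (f + b *: g) =
  dot (T f) f + b^* * dot (T f) g + b * dot (T g) f + b * b^* * dot (T g) g.
Proof.
have -> : T (f + b *: g) = T f + b *: T g by rewrite linearD linearZ.
by rewrite dotDl !dotDr !dotZl !dotZr; ring.
Qed.

Lemma dot_real x : dot x x = (Re (dot x x))%:C.
Proof. by rewrite RRe_real// ger0_real// dnorm_ge0. Qed.

Lemma Re_dot_ge0 x : 0 <= Re (dot x x).
Proof. by rewrite -lecR -dot_real dnorm_ge0. Qed.

Lemma Re_dot_gt0 x : x != 0 -> 0 < Re (dot x x).
Proof. by move=> x0; rewrite -ltcR -dot_real dnorm_gt0. Qed.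

(** A weak form of the Cauchy-Schwarz inequality, by expansion of
    [|x + b y|^2 >= 0] at [b = 1, -1, i, -i]. *)
Lemma dot_le x y :
  `|Re (dot x y)| <= (Re (dot x x) + Re (dot y y)) / 2 /\
  `|Im (dot x y)| <= (Re (dot x x) + Re (dot y y)) / 2.
Proof.
have P (b1 b2 : R) := Re_dot_ge0 (x + (b1 +i* b2) *: y).
move: P; case E : (dot x y) => [u v] P /=.
have Q (b1 b2 : R) : 0 <= Re (dot x x) + 2 * (b1 * u + b2 * v) +
    (b1 ^+ 2 + b2 ^+ 2) * Re (dot y y).
  apply: (le_trans (P b1 b2)); rewrite le_eqVlt; apply/orP; left; apply/eqP.
  have := dot_pencil idfun x y (b1 +i* b2); rewrite /= => ->.
  by rewrite (dot_conj x y) E (dot_real x) (dot_real y); simpc => /=; ring.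
have := Q 1 0; have := Q (-1) 0; have := Q 0 1; have := Q 0 (-1).
by rewrite !ler_norml => *; split; apply/andP; split; lra.
Qed.

Hypothesis dot_norm : induces_norm dot.

Lemma normr_eq1 (x : H) : (`|x| = 1) <-> (dot x x = 1).
Proof.
rewrite -dot_norm; split => [->|/eqP]; first by rewrite expr1n.
by rewrite sqrp_eq1// => /eqP.
Qed.

Lemma sqr_norm (f : H) : `|f| ^+ 2 = (Re (dot f f))%:C.
Proof. by rewrite dot_norm -dot_real. Qed.

(** Homogeneous in [h], so that perturbed vectors need not be normalised. *)
Lemma numerical_rangeP (T : {linear H -> H}) (z : R[i]) :
  numerical_range dot T z <->
  exists2 h : H, h != 0 & dot (T h) h = z * dot h h.
Proof.
split=> [[f /= f1 <-]|[h h0 hz]].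
  exists f; first by rewrite -normr_gt0 f1.
  by move/normr_eq1: f1 => ->; rewrite mulr1.
have h1 : `| `|h|^-1 *: h| = 1.
  by rewrite normrZ normfV normr_id mulVf// normr_eq0.
exists (`|h|^-1 *: h) => //.
move/normr_eq1: (h1); rewrite [T _]linearZ !dotZl !dotZr hz => e.
rewrite -[RHS]mulr1 -e; ring.
Qed.

Lemma numerical_range_quotient (T : {linear H -> H}) h : h != 0 ->
  numerical_range dot T
    ((Re (dot (T h) h) / Re (dot h h)) +i* (Im (dot (T h) h) / Re (dot h h))).
Proof.
move=> h0; apply/numerical_rangeP; exists h => //.
have N0 := Re_dot_gt0 h0.
rewrite [dot h h]dot_real; case: (dot (T h) h) => x y; simpc => /=.
by rewrite !divfK// gt_eqF.
Qed.

Lemma Im_form_ge0 (T : {linear H -> H}) h :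
  (forall z : R[i], numerical_range dot T z -> 0 <= Im z) -> 0 <= Im (dot (T h) h).
Proof.
move=> Tpos; have [->|h0] := eqVneq h 0; first by rewrite linear0r.
have := Tpos _ (numerical_range_quotient T h0).
by rewrite /= pmulr_lge0// invr_gt0 Re_dot_gt0.
Qed.

Lemma quadratic_root (A r t : R) : 0 < A -> 0 <= t ->
  exists x : R, A * x ^+ 2 + r * x - t = 0.
Proof.
move=> A0 t0; have D0 : 0 <= r ^+ 2 + 4 * A * t.
  by rewrite addr_ge0 ?sqr_ge0// !mulr_ge0// ltW.
exists ((- r + Num.sqrt (r ^+ 2 + 4 * A * t)) / (2 * A)).
have -> : A * ((- r + Num.sqrt (r ^+ 2 + 4 * A * t)) / (2 * A)) ^+ 2 +
  r * ((- r + Num.sqrt (r ^+ 2 + 4 * A * t)) / (2 * A)) - t =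
  (Num.sqrt (r ^+ 2 + 4 * A * t) ^+ 2 - (r ^+ 2 + 4 * A * t)) / (4 * A).
  by field; rewrite gt_eqF.
by rewrite sqr_sqrtr// subrr mul0r.
Qed.

Lemma real_combination (p q : R[i]) :
  exists2 w : R[i], w != 0 & complex.Im (w^* * p + w * q) = 0.
Proof.
case: p q => [p1 p2] [q1 q2].
have [/andP[/eqP e1 /eqP e2]|] := boolP ((p1 == q1) && (p2 == - q2)).
  exists 1; first exact: oner_neq0.
  by simpc => /=; lra.
rewrite negb_and => ne.
exists ((p1 - q1) +i* (p2 + q2)).
  by rewrite eq_complex /= negb_and subr_eq0 addr_eq0.
by simpc => /=; ring.
Qed.

(** Toeplitz-Hausdorff.  With [m] the target point and [d = b - a], the form
    [<T h, h> - m <h, h>] divided by [d] takes the values [- t] at [f] and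
    [1 - t] at [g].  The direction [w] makes its two cross terms add up to a
    real number [r], so that along the real line [f + x w g] it is a real
    quadratic polynomial with nonnegative discriminant, which has a root. *)
Lemma numerical_range_convex (T : {linear H -> H}) :
  convex_set (numerical_range dot T).
Proof.
move=> a b t Wa Wb /andP[t0 t1].
have [->|ab] := eqVneq a b.
  by rewrite -mulrDl -rmorphD subrK mul1r.
have [->|tn1] := eqVneq t 1.
  by rewrite subrr mul0r add0r mul1r.
have {}t1 : 0 < 1 - t by rewrite subr_gt0 lt_neqAle tn1.
case: Wa Wb => f /= /normr_eq1 f1 fa [g /= /normr_eq1 g1 gb].
set m := _ + _; set d := b - a.
have d0 : d != 0 by rewrite subr_eq0 eq_sym.
have am : a - m = - t%:C * d by rewrite /m /d rmorphB /=; ring.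
have bm : b - m = (1 - t)%:C * d by rewrite /m /d rmorphB /=; ring.
set p := (dot (T f) g - m * dot f g) / d.
set q := (dot (T g) f - m * dot g f) / d.
have [w w0 wr] := real_combination p q.
set r := complex.Re (w^* * p + w * q).
have wE : w^* * p + w * q = r%:C.
  by rewrite [LHS]complexE wr mulr0 addr0.
have [N N0 NE] : exists2 N : R, 0 < N & w * w^* = N%:C.
  exists (complex.Re w ^+ 2 + complex.Im w ^+ 2).
    by rewrite -ltcR add_Re2_Im2 exprn_gt0// normr_gt0.
  by rewrite add_Re2_Im2 sqr_normc.
have [x xE] := @quadratic_root ((1 - t) * N) r t (mulr_gt0 t1 N0) t0.
apply/numerical_rangeP; exists (f + (x%:C * w) *: g).
  (* if the vector vanished, [f] and [g] would be collinear and [a = b] *)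
  apply/eqP => /eqP; rewrite addr_eq0 -scaleNr => /eqP fE.
  case/eqP: ab; rewrite -fa -[RHS]mulr1 -f1 fE [T _]linearZ.
  rewrite !dotZl !dotZr gb g1; ring.
apply/eqP; rewrite -subr_eq0; apply/eqP.
have := dot_pencil idfun f g (x%:C * w); rewrite /= => ->.
rewrite dot_pencil fa gb f1 g1.
have pE : dot (T f) g = d * p + m * dot f g by rewrite /p; field.
have qE : dot (T g) f = d * q + m * dot g f by rewrite /q; field.
rewrite pE qE.
have -> : (x%:C * w)^* = x%:C * w^*.
  by rewrite rmorphM; congr (_ * _); exact: conjc_real.
have -> : forall y z u : R[i],
  a + x%:C * u * (d * p + m * y) + x%:C * w * (d * q + m * z) +
  x%:C * w * (x%:C * u) * b -
  m * (1 + x%:C * u * y + x%:C * w * z + x%:C * w * (x%:C * u) * 1) =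
  (a - m) + d * x%:C * (u * p + w * q) + x%:C ^+ 2 * (w * u) * (b - m).
  by move=> *; ring.
rewrite wE NE am bm.
transitivity (d * ((1 - t) * N * x ^+ 2 + r * x - t)%:C);
  last by rewrite xE mulr0.
have rD (y z : R) : (y + z)%:C = y%:C + z%:C by exact: rmorphD.
have rM (y z : R) : (y * z)%:C = y%:C * z%:C by exact: rmorphM.
rewrite [in RHS]rD [in RHS]rD 2![in RHS]rM expr2 2![in RHS]rM rmorphN /=; ring.
Qed.

Lemma rigid_image_numerical_range (A T : {linear H -> H}) u l :
  (forall x, T x = u *: (A x - l *: x)) ->
  rigid_image l u (numerical_range dot A) = numerical_range dot T.
Proof.
move=> TE.
have E (f : H) : `|f| = 1 -> u * (dot (A f) f - l) = dot (T f) f.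
  move=> /normr_eq1 f1.
  rewrite TE; transitivity (u * dot (A f - l *: f) f); last by apply/esym/dotZl.
  by rewrite linearBl; congr (_ * (_ - _));
    rewrite -[LHS]mulr1 -f1; apply/esym/dotZl.
apply/seteqP; split => [_ [_ [f /= f1 <-] <-]|_ [f /= f1 <-]].
  by exists f => //=; rewrite E.
by exists (dot (A f) f); [exists f|rewrite E].
Qed.

(** * Points close to the supporting line *)

(** Real and imaginary parts of the perturbed form at [b = s] and [b = - s],
    where [<T f, f> = x0 + i y0], [<T g, f> = p + i q], [<T g, g> = x2 + i y2]
    and [G = |g|^2].  The last three hypotheses express that the imaginary part
    is nonnegative at [b = s], [- s] and [i s]. *)
Lemma pencil_form_bounds (k D G s x0 y0 x2 y2 p q : R) :
  0 < s -> k <= G -> s * (2 + 2 * D) <= k ->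
  - s ^+ 2 <= x0 <= s ^+ 2 -> y0 <= s ^+ 2 -> - D <= x2 <= D -> y2 <= D ->
  0 <= y0 + s * q + s ^+ 2 * y2 -> 0 <= y0 - s * q + s ^+ 2 * y2 ->
  0 <= y0 + s * (p - G) + s ^+ 2 * y2 ->
  [/\ k * s <= x0 + s * (G + p) + s ^+ 2 * x2,
      x0 - s * (G + p) + s ^+ 2 * x2 <= - (k * s),
      y0 + s * q + s ^+ 2 * y2 <= (2 + 2 * D) * s ^+ 2 &
      y0 - s * q + s ^+ 2 * y2 <= (2 + 2 * D) * s ^+ 2].
Proof.
move=> s0 kG sk /andP[x0l x0u] y0u /andP[x2l x2u] y2u P1 P2 P3.
have s20 : 0 < s ^+ 2 by rewrite exprn_gt0.
have sy2 : s ^+ 2 * y2 <= s ^+ 2 * D by rewrite ler_pM2l.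
have sx2l : s ^+ 2 * - D <= s ^+ 2 * x2 by rewrite ler_pM2l.
have sx2u : s ^+ 2 * x2 <= s ^+ 2 * D by rewrite ler_pM2l.
have sgk : s * k <= s * G by rewrite ler_pM2l.
have ssk : s ^+ 2 * (2 + 2 * D) <= s * k by rewrite expr2 -mulrA ler_pM2l.
by split; lra.
Qed.

Lemma pencil_norm_bounds (a G s b x0 : R) :
  0 < s -> 0 <= G <= a -> `|x0| <= (1 + a) / 2 -> s * (2 * (1 + a)) <= 1 ->
  `|b| = s -> 2^-1 <= 1 + 2 * b * x0 + b ^+ 2 * G <= 4.
Proof.
move=> s0 /andP[G0 Ga] x0a sa bs.
have bx : `|b * x0| <= s * ((1 + a) / 2) by rewrite normrM bs ler_pM2l.
move: bx; rewrite ler_norml => /andP[bl bu].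
have b2 : b ^+ 2 = s ^+ 2 by rewrite -bs real_normK ?num_real.
have s1 : s <= 1.
  have : 0 <= s * a by apply: mulr_ge0; lra.
  lra.
have sG : 0 <= s * G <= 1.
  rewrite mulr_ge0 ?(ltW s0)//=.
  have : s * G <= s * a by rewrite ler_pM2l.
  lra.
have : 0 <= s ^+ 2 * G <= 1.
  case/andP: sG => sG0 sG1.
  by rewrite expr2 -mulrA mulr_ge0 ?(ltW s0)//= mulr_ile1// ltW.
by rewrite b2 => /andP[? ?]; apply/andP; split; lra.
Qed.

(** Dividing by the squared norm of the perturbed vector, which lies between
    1/2 and 4, costs a constant factor. *)
Lemma quotient_bounds (x y N : R) : 2^-1 <= N <= 4 ->
  (0 <= y -> y <= x -> y / 4 <= x / N) /\
  (0 <= y -> x <= y -> x / N <= 2 * y).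
Proof.
move=> /andP[Nl Nu]; have N0 : 0 < N by lra.
split=> y0 yx; [rewrite ler_pdivlMr//|rewrite ler_pdivrMr//].
  have : y * N <= y * 4 by rewrite ler_wpM2l.
  lra.
have : y * 2^-1 <= y * N by rewrite ler_wpM2l.
lra.
Qed.

(** The two points are the values of the numerical range at [f + s g] and
    [f - s g], where [g = T f] and [f] is a unit vector with [<T f, f>] of size
    [s^2]. *)
Lemma tangent_points (T : {linear H -> H}) (a k : R)
  (Ta : forall f, Re (dot (T f) (T f)) <= a * Re (dot f f))
  (k0 : 0 < k)
  (Tk : forall f, k * Re (dot f f) <= Re (dot (T f) (T f)))
  (Tpos : forall z : R[i], numerical_range dot T z -> 0 <= Im z)
  (T0 : forall e : R, 0 < e -> exists2 z : R[i], numerical_range dot T z &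
     `|Re z| <= e /\ `|Im z| <= e) :
  hugs_real_axis (numerical_range dot T).
Proof.
have [a0|a0] := ltP 0 a; last first.
  have [z [f /= /normr_eq1 f1 _] _] := T0 1 ltr01.
  have := Ta f; have := Tk f; rewrite f1 /= !mulr1 => h1 h2.
  by have := lt_le_trans k0 (le_trans h1 (le_trans h2 a0)); rewrite ltxx.
(* [D] bounds both parts of [<T g, g>], by [|T g|^2 <= a^2] and [|g|^2 <= a] *)
have [D D0 DE] : exists2 D : R, 0 < D & (a ^+ 2 + a) / 2 = D.
  by exists ((a ^+ 2 + a) / 2); rewrite ?divr_gt0// addr_gt0// exprn_gt0.
(* below the first bound on [s] the error terms are at most [k s]; below the
   second one [|f + b g|^2] stays between 1/2 and 4 *)
exists (4 + 4 * D), (k / 4),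
  (Num.min (k / (2 + 2 * D)) (1 / (2 * (1 + a)))).
split; [lra|lra| |].
  by rewrite lt_min; apply/andP; split; apply: divr_gt0; lra.
move=> s /andP[s0]; rewrite le_min ler_pdivlMr; last lra.
rewrite ler_pdivlMr; last lra.
move=> /andP[sk sa].
have [_ [f /= /normr_eq1 f1 <-] [fx fy]] := T0 _ (exprn_gt0 2 s0).
set g := T f.
have gk : k <= Re (dot g g) by have := Tk f; rewrite f1 /= mulr1.
have ga : Re (dot g g) <= a by have := Ta f; rewrite f1 /= mulr1.
have Tga : Re (dot (T g) (T g)) <= a ^+ 2.
  by apply: (le_trans (Ta g)); rewrite expr2 ler_wpM2l// ltW.
have [x2D y2D] := dot_le (T g) g.
have [uD _] := dot_le f g.
have pos b := Im_form_ge0 (f + b *: g) Tpos.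
have Wq b := @numerical_range_quotient T (f + b *: g).
have fE b := dot_pencil T f g b.
have nE b := dot_pencil idfun f g b.
(* [<f, g>] is the conjugate of [<g, f> = <T f, f>] *)
move: fx fy x2D y2D uD gk ga Tga fE nE; rewrite /= (dot_conj g f) -/g f1.
rewrite (dot_real g); move: (Re (dot g g)) (Re (dot (T g) (T g))) => G G2.
case: (dot g f) (dot (T g) g) (dot (T g) f) => [x0 y0] [x2 y2] [p q] /=.
move=> x0s y0s x2D y2D x0D gk ga Tga fE nE.
have FE (b1 b2 : R) :
    dot (T (f + (b1 +i* b2) *: g)) (f + (b1 +i* b2) *: g) =
    (x0 + b1 * (G + p) - b2 * q + (b1 ^+ 2 + b2 ^+ 2) * x2) +i*
    (y0 + b1 * q + b2 * (p - G) + (b1 ^+ 2 + b2 ^+ 2) * y2).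
  by rewrite fE; simpc; congr (_ +i* _); ring.
have NE (b : R) : Re (dot (f + b%:C *: g) (f + b%:C *: g)) =
    1 + 2 * b * x0 + b ^+ 2 * G.
  by rewrite nE; simpc => /=; ring.
have W (b : R) : `|b| = s ->
    exists2 N : R, 2^-1 <= N <= 4 & numerical_range dot T
      (((x0 + b * (G + p) + b ^+ 2 * x2) / N) +i*
       ((y0 + b * q + b ^+ 2 * y2) / N)).
  move=> bs; have NP : 2^-1 <= 1 + 2 * b * x0 + b ^+ 2 * G <= 4.
    apply: (pencil_norm_bounds s0 _ _ sa bs).
      by rewrite ga andbT; clear - gk k0; lra.
    by apply: (le_trans x0D); clear - ga; lra.
  exists (1 + 2 * b * x0 + b ^+ 2 * G) => //.
  have Nb : 0 < 1 + 2 * b * x0 + b ^+ 2 * G.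
    by case/andP: NP => + _; clear; lra.
  have := Wq b%:C; rewrite NE FE /= !mul0r expr0n /= !addr0 subr0; apply.
  by apply: contraTneq Nb => e0; rewrite -NE e0 linear0r ltxx.
have {}x2D : `|x2| <= D by apply: (le_trans x2D); clear - DE ga Tga; lra.
have {}y2D : y2 <= D.
  by apply: (le_trans (ler_norm _)); apply: (le_trans y2D); clear - DE ga Tga; lra.
have [] := @pencil_form_bounds k D G s x0 y0 x2 y2 p q s0 gk sk.
- by rewrite -ler_norml.
- exact: le_trans (ler_norm _) y0s.
- by rewrite -ler_norml.
- exact: y2D.
- by have := pos s%:C; rewrite FE /= mul0r expr0n /= !addr0.
- by have := pos (- s)%:C; rewrite FE /= mul0r expr0n /= !addr0 mulNr sqrrN.
- by have := pos (0 +i* s); rewrite FE /= mul0r expr0n /= addr0 add0r.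
have [N NP WN] : exists2 N : R, 2^-1 <= N <= 4 & numerical_range dot T
    (((x0 + s * (G + p) + s ^+ 2 * x2) / N) +i*
     ((y0 + s * q + s ^+ 2 * y2) / N)) by apply: W; rewrite gtr0_norm.
have [M MP WM] : exists2 N : R, 2^-1 <= N <= 4 & numerical_range dot T
    (((x0 - s * (G + p) + s ^+ 2 * x2) / N) +i*
     ((y0 - s * q + s ^+ 2 * y2) / N)).
  by have := W (- s); rewrite !mulNr sqrrN; apply; rewrite normrN gtr0_norm.
move=> x1 x3 y1 y3.
have ks : 0 <= k * s by rewrite mulr_ge0 ?ltW.
have Ds : 0 <= (2 + 2 * D) * s ^+ 2.
  by rewrite mulr_ge0 ?sqr_ge0//; clear - D0; lra.
have kE : k / 4 * s = k * s / 4 by rewrite mulrAC.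
have DsE : (4 + 4 * D) * s ^+ 2 = 2 * ((2 + 2 * D) * s ^+ 2) by ring.
eexists; eexists; split; [exact: WN|exact: WM|].
rewrite /= kE DsE; split.
- exact: (proj1 (quotient_bounds _ _ NP) ks x1).
- have x3N : k * s <= - (x0 - s * (G + p) + s ^+ 2 * x2) by rewrite lerNr.
  by have := proj1 (quotient_bounds _ _ MP) ks x3N; rewrite mulNr lerNr.
- exact: (proj2 (quotient_bounds _ _ NP) Ds y1).
- exact: (proj2 (quotient_bounds _ _ MP) Ds y3).
Qed.

(** * Approximate eigenvectors *)

(** A bounded inverse of [A - l] would carry vectors tending to 0 to the unit
    vectors [v n]. *)
Lemma approximate_eigenvectors (A : {linear H -> H}) (l : R[i])
    (v : nat -> H) :
  (forall n, `|v n| = 1) -> (fun n => A (v n) - l *: v n) @ \oo --> (0 : H) ->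
  approximate_point_spectrum A l.
Proof.
move=> v1 v0; split; last by exists v.
move=> [B [[M BM] BA _]].
have /cvgr0Pnorm_lt cv := v0.
have e0 : 0 < (`|M| + 1)^-1%:C by rewrite ltcR invr_gt0 ltr_wpDl.
have [n _ /(_ n (leqnn n)) /= hn] := cv _ e0.
have := BM (A (v n) - l *: v n); rewrite BA v1 => h.
have : (1 : R[i]) < 1; last by rewrite ltxx.
apply: (le_lt_trans h); apply: (@le_lt_trans _ _ ((`|M|)%:C * `|A (v n) - l *: v n|)).
  by rewrite ler_wpM2r// lecR ler_norm.
apply: (@le_lt_trans _ _ ((`|M|)%:C * (`|M| + 1)^-1%:C)).
  by rewrite ler_wpM2l ?lecR// ltW.
rewrite -rmorphM ltcR ltr_pdivrMr ?mul1r ?ltrDl// ltr_wpDl.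
Qed.

Lemma bounded_below (T : {linear H -> H}) :
  ~ (exists v : nat -> H, (forall n, `|v n| = 1) /\
     (fun n => T (v n)) @ \oo --> (0 : H)) ->
  exists2 k : R, 0 < k & forall f, k * Re (dot f f) <= Re (dot (T f) (T f)).
Proof.
move=> nv; apply: contrapT => nk; apply: nv.
have P (n : nat) : exists f, `|f| = 1 /\ `|T f| < (n.+1%:R^-1)%:C.
  apply: contrapT => nf; apply: nk; exists ((n.+1%:R^-1) ^+ 2).
    by rewrite exprn_gt0// invr_gt0.
  move=> f; rewrite leNgt; apply/negP => h; apply: nf.
  have f0 : f != 0.
    by apply: contraTneq h => ->;
      rewrite [T 0]linear0 [dot 0 0]linear0r -leNgt mulr0.
  exists (`|f|^-1 *: f); split.
    by rewrite normrZ normfV normr_id mulVf// normr_eq0.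
  rewrite linearZ normrZ normfV normr_id mulrC ltr_pdivrMr ?normr_gt0//.
  rewrite -(ltr_pXn2r (ltn0Sn 1)) ?nnegrE ?mulr_ge0 ?ler0c//.
  by rewrite exprMn !sqr_norm -rmorphXn -rmorphM ltcR.
have [v vP] := choice P; exists v; split; first by move=> n; have [] := vP n.
apply/cvgr0Pnorm_lt => e e0.
have eE : e = (Re e)%:C by rewrite RRe_real// gtr0_real.
have e0' : 0 < Re e by rewrite -ltcR -eE.
have := near_infty_natSinv_lt (PosNum e0').
apply: filterS => n /= ne; rewrite eE.
by have [_ h] := vP n; apply: (lt_trans h); rewrite ltcR.
Qed.

Lemma rotated_hugs_real_axis (A T : {linear H -> H}) (l u : R[i]) :
  bounded_operator A -> closure (numerical_range dot A) l -> `|u| = 1 ->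
  (forall x, T x = u *: (A x - l *: x)) ->
  numerical_range dot T `<=` [set z | 0 <= Im z] ->
  ~ (exists v : nat -> H, (forall n, `|v n| = 1) /\
     (fun n => A (v n) - l *: v n) @ \oo --> (0 : H)) ->
  hugs_real_axis (numerical_range dot T).
Proof.
move=> [M AM] cl u1 TE Tpos nv.
have Tn x : `|T x| = `|A x - l *: x| by rewrite TE normrZ u1 mul1r.
have [k k0 Tk] : exists2 k : R, 0 < k &
    forall f, k * Re (dot f f) <= Re (dot (T f) (T f)).
  apply: bounded_below => -[v [v1 v0]]; apply: nv; exists v; split => //.
  apply/cvgr0Pnorm_lt => e e0; move/cvgr0Pnorm_lt: v0 => /(_ e e0).
  by apply: filterS => n; rewrite Tn.
pose m := `|M| + Re `|l|.
have lE : `|l| = (Re `|l|)%:C by rewrite RRe_real// ger0_real.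
have m0 : 0 <= m by rewrite addr_ge0// -ler0c -lE.
have Tm x : `|T x| <= m%:C * `|x|.
  rewrite Tn (le_trans (ler_normB _ _))// normrZ /m rmorphD /= -lE mulrDl lerD2r.
  by apply: (le_trans (AM x)); rewrite ler_wpM2r// lecR ler_norm.
apply: (@tangent_points T (m ^+ 2) k) => // [f|e e0].
  have := Tm f; rewrite -(ler_pXn2r (ltn0Sn 1)) ?nnegrE ?mulr_ge0 ?ler0c//.
  by rewrite exprMn !sqr_norm -rmorphXn -rmorphM lecR.
have : nbhs l (ball l e%:C) by apply: nbhsx_ballx; rewrite ltcR.
move=> /cl [w [Ww lw]].
exists (u * (w - l)).
  by rewrite -(rigid_image_numerical_range TE); exists w.
have [] := @Re_Im_lt_norm _ (u * (w - l)) e.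
  by rewrite normrM u1 mul1r distrC.
by move=> ? ?; split; rewrite ltW.
Qed.

End NumericalRange.

Unset Implicit Arguments.

Theorem theorem2 (R : realType) (H : completeNormedModType R[i])
  (dot : {dot H for conjC}) (dot_norm : induces_norm dot)
  (A : {linear H -> H}) (A_bounded : bounded_operator A)
  (lambda : R[i])
  (lambda_boundary : boundary (numerical_range dot A) lambda)
  (lambda_curv : infinite_upper_curvature (numerical_range dot A) lambda) :
  approximate_point_spectrum A lambda.
Proof.
apply: contrapT => nap.
have nv : ~ exists v : nat -> H, (forall n, `|v n| = 1) /\
     (fun n => A (v n) - lambda *: v n) @ \oo --> (0 : H).
  by move=> [v [v1 v0]]; exact/nap/(approximate_eigenvectors v1 v0).
have [cl _] := lambda_boundary.
case: lambda_curv => [[_ [a [b [b0 Wab]]]]|[_ _ [u [u1 [Wpos _] curv]]]].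
  have [u u1 [m m0 um]] := sector_rotation lambda a b0.
  pose T : {linear H -> H} := u \*: (A \- lambda \*: idfun).
  have TE x : T x = u *: (A x - lambda *: x) by [].
  have WT z : numerical_range dot T z ->
      0 <= complex.Im z /\ m * complex.Re z <= complex.Im z.
    rewrite -(rigid_image_numerical_range dot_norm TE) => -[w /Wab Ww <-].
    exact: um.
  apply: (@hugs_real_axis_not_steep _ (numerical_range dot T) m m0).
    by move=> z /WT[].
  apply: (rotated_hugs_real_axis dot_norm A_bounded cl u1 TE _ nv).
  by move=> z /WT[].
pose T : {linear H -> H} := u \*: (A \- lambda \*: idfun).
have TE x : T x = u *: (A x - lambda *: x) by [].
rewrite (rigid_image_numerical_range dot_norm TE) in Wpos curv.
apply: (upper_curvature_finite _ Wpos _ curv).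
  exact: numerical_range_convex.
exact: (rotated_hugs_real_axis dot_norm A_bounded cl u1 TE Wpos nv).
Qed.
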